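(* Let $G$ be a group. There is a unique braided strict monoidal functor $$\mathbf{Tangle}\to\mathbf{TSpan}_G$$ taking the generating object $X$ of $\mathbf{Tangle}$ to $G$ and the structure maps $\eta:I\to X\otimes X$, $\epsilon:X\otimes X\to I$ of $\mathbf{Tangle}$ to the corresponding arrows $\Delta n:I\to G\otimes G$ and $e\nabla:G\otimes G\to I$ in $\mathbf{TSpan}_G$.
   Context: Composition is written right to left. Braided strict monoidal category: a category $\mathbf{C}$ with a functor $\otimes:\mathbf{C}\times\mathbf{C}\to\mathbf{C}$, strictly associative and strictly unital with unit object $I$, and a natural family of isomorphisms $\tau_{A,B}:A\otimes B\to B\otimes A$ (the twist) such that $\tau_{A,B\otimes C}=(1_B\otimes\tau_{A,C})(\tau_{A,B}\otimes 1_C)$ and $\tau_{A\otimes B,C}=(\tau_{A,C}\otimes 1_B)(1_A\otimes\tau_{B,C})$. A braided strict monoidal functor preserves $\otimes$, $I$ and $\tau$ strictly. Tangle algebra: an object $X$ with arrows $\eta:I\to X\otimes X$ and $\epsilon:X\otimes X\to I$ such that $(\epsilon\otimes 1)(1\otimes\eta)=1=(1\otimes\epsilon)(\eta\otimes 1)$, $\epsilon\tau=\epsilon$ and $\tau\eta=\eta$. $\mathbf{Tangle}$ is the free braided strict monoidal category generated by one object $X$ equipped with a tangle algebra structure $(\eta,\epsilon)$. Definition of $\mathbf{TSpan}_G$: the objects are the formal powers $G^n$ ($n\ge 0$) of $G$. An arrow from $G^m$ to $G^n$ is an isomorphism class of spans of sets $G^m\xleftarrow{\delta_0}S\xrightarrow{\delta_1}G^n$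 such that there exists a function $G\times S\to S$, written $(g,s)\mapsto gs$, for which $s\mapsto gs$ is a bijection for each $g\in G$, and satisfying: 1) if $\delta_0(s)=(x_1,\dots,x_m)$ and $\delta_1(s)=(y_1,\dots,y_n)$ then $\delta_0(gs)=(x_1^g,\dots,x_m^g)$ and $\delta_1(gs)=(y_1^g,\dots,y_n^g)$ for all $g\in G$, where $x^g=gxg^{-1}$; 2) if $\delta_0(s)=(x_1,\dots,x_m)$ and $\delta_1(s)=(y_1,\dots,y_n)$ then $x_1\cdots x_m(y_1\cdots y_n)^{-1}\in Z(G)$, the center of $G$. Composition (by pullback) and identities are those of spans. $\mathbf{TSpan}_G$ is braided strict monoidal with $G^m\otimes G^n=G^{m+n}$, unit $I=G^0$ (the one-point set), tensor of arrows the product of spans, and twist $\tau_{m,n}$ the span given by the function $(x,y)\mapsto(y_1^{\overline{x}},\dots,y_n^{\overline{x}},x_1,\dots,x_m)$ with $\overline{x}=x_1\cdots x_m$. In $\mathbf{TSpan}_G$, $\nabla:G\otimes G\to G$ is the group multiplication viewed as a span, $n:I\to G$ is the group identity viewed as a span, and $\Delta:G\to G\otimes G$, $e:G\to I$ are the opposite spans of $\nabla$, $n$ (legs interchanged). Thus $e\nabla$ is the span $G\times G\leftarrow\{(x,y):xy=1\}\to I$ and $\Delta n$ is its opposite. *)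

(* Defs.v *)
From mathcomp Require Import all_boot.
From mathcomp Require Import boolp.
From Corelib Require Import RelationClasses.

Set Implicit Arguments.
Unset Strict Implicit.
Unset Printing Implicit Defensive.

Local Open Scope group_scope.

(* Transport of an arrow along equalities of its source and its target.  In a
   strict monoidal category A ⊠ (B ⊠ C) and (A ⊠ B) ⊠ C are equal objects, but
   not convertible ones; equations between arrows whose types differ by such
   equalities are stated through this transport. *)
Definition cast2 (O : Type) (H : O -> O -> Type) (A A' B B' : O)
    (eA : A = A') (eB : B = B') (f : H A B) : H A' B' :=
  ecast Y (H A' Y) eB (ecast X (H X B) eA f).

Record category := Category {
  ob :> Type;
  hom : ob -> ob -> Type;
  idm : forall A, hom A A;
  mcomp : forall A B C, hom B C -> hom A B -> hom A C;
  mcomp1m : forall A B (f : hom A B), mcomp (idm B) f = f;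
  mcompm1 : forall A B (f : hom A B), mcomp f (idm A) = f;
  mcompA : forall A B C D (h : hom C D) (g : hom B C) (f : hom A B),
    mcomp h (mcomp g f) = mcomp (mcomp h g) f
}.

Arguments idm {c} A.

(* Right to left: g ∘ f is f followed by g. *)
Notation "g ∘ f" := (mcomp g f) (at level 40, left associativity).

Definition is_iso (C : category) (A B : C) (f : hom A B) : Prop :=
  exists g : hom B A, g ∘ f = idm A /\ f ∘ g = idm B.

Record strict_monoidal := StrictMonoidal {
  smcat :> category;
  munit : smcat;
  oten : smcat -> smcat -> smcat;
  mten : forall A B A' B' : smcat,
    hom A B -> hom A' B' -> hom (oten A A') (oten B B');
  mten1 : forall A B : smcat, mten (idm A) (idm B) = idm (oten A B);
  mten_comp : forall (A B C A' B' C' : smcat)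
      (g : hom B C) (f : hom A B) (g' : hom B' C') (f' : hom A' B'),
    mten (g ∘ f) (g' ∘ f') = mten g g' ∘ mten f f';
  otenA : forall A B C : smcat, oten A (oten B C) = oten (oten A B) C;
  oten1l : forall A : smcat, oten munit A = A;
  oten1r : forall A : smcat, oten A munit = A;
  mtenA : forall (A B C A' B' C' : smcat)
      (f : hom A A') (g : hom B B') (h : hom C C'),
    cast2 (otenA A B C) (otenA A' B' C') (mten f (mten g h))
    = mten (mten f g) h;
  mten1l : forall (A B : smcat) (f : hom A B),
    cast2 (oten1l A) (oten1l B) (mten (idm munit) f) = f;
  mten1r : forall (A B : smcat) (f : hom A B),
    cast2 (oten1r A) (oten1r B) (mten f (idm munit)) = f
}.

Arguments munit {s}.
Notation "A ⊠ B" := (oten A B) (at level 38, left associativity).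
Notation "f ⊗ g" := (mten f g) (at level 38, left associativity).

Record braided_strict_monoidal := BraidedStrictMonoidal {
  bsmcat :> strict_monoidal;
  twist : forall A B : bsmcat, hom (A ⊠ B) (B ⊠ A);
  twist_iso : forall A B : bsmcat, is_iso (twist A B);
  twist_nat : forall (A A' B B' : bsmcat) (f : hom A A') (g : hom B B'),
    twist A' B' ∘ (f ⊗ g) = (g ⊗ f) ∘ twist A B;
  twist_tenr : forall A B C : bsmcat,
    cast2 (otenA A B C) (esym (otenA B C A)) (twist A (B ⊠ C))
    = (idm B ⊗ twist A C)
      ∘ cast2 (erefl _) (esym (otenA B A C)) (twist A B ⊗ idm C);
  twist_tenl : forall A B C : bsmcat,
    cast2 (esym (otenA A B C)) (otenA C A B) (twist (A ⊠ B) C)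
    = (twist A C ⊗ idm B)
      ∘ cast2 (erefl _) (otenA A C B) (idm A ⊗ twist B C)
}.

Record bsm_functor (C D : braided_strict_monoidal) := BSMFunctor {
  fob :> C -> D;
  fhom : forall A B : C, hom A B -> hom (fob A) (fob B);
  fhom1 : forall A : C, fhom (idm A) = idm (fob A);
  fhom_comp : forall (A B E : C) (g : hom B E) (f : hom A B),
    fhom (g ∘ f) = fhom g ∘ fhom f;
  fob_unit : fob munit = munit;
  fob_ten : forall A B : C, fob (A ⊠ B) = fob A ⊠ fob B;
  fhom_ten : forall (A B A' B' : C) (f : hom A B) (g : hom A' B'),
    cast2 (fob_ten A A') (fob_ten B B') (fhom (f ⊗ g)) = fhom f ⊗ fhom g;
  fhom_twist : forall A B : C,
    cast2 (fob_ten A B) (fob_ten B A) (fhom (twist A B))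
    = twist (fob A) (fob B)
}.

(* The elements are literally the equivalence classes.  The library's
   {eq_quot _} is not used: it would need a choiceType structure on the type of
   all spans, which is too large for the universe of choiceType. *)

Section Quotient.
Variables (T : Type) (R : T -> T -> Prop) (eqR : Equivalence R).

Definition quot : Type := {c : T -> Prop | exists x, c = R x}.
Definition cls (x : T) : quot := exist _ (R x) (ex_intro _ x (erefl _)).
Definition rep (a : quot) : T := sval (cid (svalP a)).

Lemma repK a : cls (rep a) = a.
Proof.
by case: a => c cR; apply: eq_exist; rewrite /rep; case: cid => x /= <-.
Qed.

Lemma clsP x y : cls x = cls y <-> R x y.
Proof.
split=> [[e]|Rxy]; first by rewrite e; reflexivity.
apply: eq_exist; apply/funext => z; apply/propext.
by split=> h; [transitivity x; [symmetry|]|transitivity y].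
Qed.

Lemma rep_cls x : R (rep (cls x)) x.
Proof. by apply/clsP; rewrite repK. Qed.

Lemma clsW (P : quot -> Prop) : (forall x, P (cls x)) -> forall a, P a.
Proof. by move=> h a; rewrite -(repK a). Qed.

End Quotient.

(* The free braided strict monoidal category on an object with a tangle algebra
   structure, by generators and relations.  Its objects form the free monoid on
   one generator: n stands for the n-th tensor power of the generating object.
   Its arrows are the formal composites below modulo tangle_eq. *)
Inductive tangle_term : nat -> nat -> Type :=
| Tid n : tangle_term n n
| Tcomp m n p : tangle_term n p -> tangle_term m n -> tangle_term m p
| Tten m n m' n' :
    tangle_term m n -> tangle_term m' n' -> tangle_term (m + m') (n + n')
| Ttwist m n : tangle_term (m + n) (n + m)
| TtwistV m n : tangle_term (n + m) (m + n)
| Teta : tangle_term 0 2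
| Teps : tangle_term 2 0.

(* The congruence generated by the laws of braided strict monoidal categories
   and by the tangle algebra laws for (Teta, Teps) on the object 1.
   In the last four clauses the tensor products involved are convertible to
   numerals, so that no transport is needed. *)
Inductive tangle_eq :
  forall m n, tangle_term m n -> tangle_term m n -> Prop :=
| Teq_refl m n (f : tangle_term m n) : tangle_eq f f
| Teq_sym m n (f g : tangle_term m n) : tangle_eq f g -> tangle_eq g f
| Teq_trans m n (f g h : tangle_term m n) :
    tangle_eq f g -> tangle_eq g h -> tangle_eq f h
| Teq_comp m n p (g g' : tangle_term n p) (f f' : tangle_term m n) :
    tangle_eq g g' -> tangle_eq f f' -> tangle_eq (Tcomp g f) (Tcomp g' f')
| Teq_ten m n m' n' (f g : tangle_term m n) (f' g' : tangle_term m' n') :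
    tangle_eq f g -> tangle_eq f' g' -> tangle_eq (Tten f f') (Tten g g')
| Teq_comp1m m n (f : tangle_term m n) : tangle_eq (Tcomp (Tid n) f) f
| Teq_compm1 m n (f : tangle_term m n) : tangle_eq (Tcomp f (Tid m)) f
| Teq_compA m n p q (h : tangle_term p q) (g : tangle_term n p)
    (f : tangle_term m n) :
    tangle_eq (Tcomp h (Tcomp g f)) (Tcomp (Tcomp h g) f)
| Teq_ten1 m n : tangle_eq (Tten (Tid m) (Tid n)) (Tid (m + n))
| Teq_ten_comp m n p m' n' p' (g : tangle_term n p) (f : tangle_term m n)
    (g' : tangle_term n' p') (f' : tangle_term m' n') :
    tangle_eq (Tten (Tcomp g f) (Tcomp g' f')) (Tcomp (Tten g g') (Tten f f'))
| Teq_tenA m n p m' n' p' (f : tangle_term m m') (g : tangle_term n n')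
    (h : tangle_term p p') :
    tangle_eq (cast2 (addnA m n p) (addnA m' n' p') (Tten f (Tten g h)))
              (Tten (Tten f g) h)
| Teq_ten1l m n (f : tangle_term m n) :
    tangle_eq (cast2 (add0n m) (add0n n) (Tten (Tid 0) f)) f
| Teq_ten1r m n (f : tangle_term m n) :
    tangle_eq (cast2 (addn0 m) (addn0 n) (Tten f (Tid 0))) f
| Teq_twistK m n : tangle_eq (Tcomp (TtwistV m n) (Ttwist m n)) (Tid (m + n))
| Teq_twistVK m n : tangle_eq (Tcomp (Ttwist m n) (TtwistV m n)) (Tid (n + m))
| Teq_twist_nat m n m' n' (f : tangle_term m m') (g : tangle_term n n') :
    tangle_eq (Tcomp (Ttwist m' n') (Tten f g)) (Tcomp (Tten g f) (Ttwist m n))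
| Teq_twist_tenr m n p :
    tangle_eq (cast2 (addnA m n p) (esym (addnA n p m)) (Ttwist m (n + p)))
              (Tcomp (Tten (Tid n) (Ttwist m p))
                     (cast2 (erefl _) (esym (addnA n m p))
                            (Tten (Ttwist m n) (Tid p))))
| Teq_twist_tenl m n p :
    tangle_eq (cast2 (esym (addnA m n p)) (addnA p m n) (Ttwist (m + n) p))
              (Tcomp (Tten (Ttwist m p) (Tid n))
                     (cast2 (erefl _) (addnA m p n)
                            (Tten (Tid m) (Ttwist n p))))
| Teq_zigzag_l :
    tangle_eq (Tcomp (Tten Teps (Tid 1)) (Tten (Tid 1) Teta)) (Tid 1)
| Teq_zigzag_r :
    tangle_eq (Tcomp (Tten (Tid 1) Teps) (Tten Teta (Tid 1))) (Tid 1)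
| Teq_eps_twist : tangle_eq (Tcomp Teps (Ttwist 1 1)) Teps
| Teq_twist_eta : tangle_eq (Tcomp (Ttwist 1 1) Teta) Teta.

#[export] Instance tangle_eq_equiv m n : Equivalence (@tangle_eq m n).
Proof.
by split=> [f|f g|f g h]; [apply: Teq_refl|apply: Teq_sym|apply: Teq_trans].
Qed.

Definition tangle_hom m n : Type := quot (@tangle_eq m n).
Definition tangle_cls m n (f : tangle_term m n) : tangle_hom m n :=
  cls (@tangle_eq m n) f.

Definition tangle_comp m n p (g : tangle_hom n p) (f : tangle_hom m n) :=
  tangle_cls (Tcomp (rep g) (rep f)).

Definition tangle_ten m n m' n' (f : tangle_hom m n) (g : tangle_hom m' n') :=
  tangle_cls (Tten (rep f) (rep g)).

Lemma tangle_clsP m n (f g : tangle_term m n) :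
  tangle_cls f = tangle_cls g <-> tangle_eq f g.
Proof. exact: clsP. Qed.

Lemma tangle_compE m n p (g : tangle_term n p) (f : tangle_term m n) :
  tangle_comp (tangle_cls g) (tangle_cls f) = tangle_cls (Tcomp g f).
Proof. by apply/tangle_clsP; apply: Teq_comp; apply: rep_cls. Qed.

Lemma tangle_tenE m n m' n' (f : tangle_term m n) (g : tangle_term m' n') :
  tangle_ten (tangle_cls f) (tangle_cls g) = tangle_cls (Tten f g).
Proof. by apply/tangle_clsP; apply: Teq_ten; apply: rep_cls. Qed.

Lemma tangle_castE m m' n n' (em : m = m') (en : n = n')
    (f : tangle_term m n) :
  cast2 em en (tangle_cls f) = tangle_cls (cast2 em en f).
Proof. by case: _ / em; case: _ / en. Qed.

Lemma tangle_homW m n (P : tangle_hom m n -> Prop) :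
  (forall f, P (tangle_cls f)) -> forall f, P f.
Proof. exact: clsW. Qed.

Definition tangleE := (tangle_compE, tangle_tenE, tangle_castE).

Definition Tangle_category : category.
Proof.
refine (@Category nat tangle_hom (fun n => tangle_cls (Tid n)) tangle_comp
  _ _ _).
- move=> m n; apply: tangle_homW => f; rewrite tangleE.
  exact/tangle_clsP/Teq_comp1m.
- move=> m n; apply: tangle_homW => f; rewrite tangleE.
  exact/tangle_clsP/Teq_compm1.
- move=> m n p q; apply: tangle_homW => h; apply: tangle_homW => g.
  apply: tangle_homW => f; rewrite !tangleE; exact/tangle_clsP/Teq_compA.
Defined.

Definition Tangle_monoidal : strict_monoidal.
Proof.
refine (@StrictMonoidal Tangle_category 0 addn tangle_ten _ _ addnA add0n addn0
  _ _ _).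
- move=> m n /=; rewrite tangleE; exact/tangle_clsP/Teq_ten1.
- move=> m n p m' n' p'; apply: tangle_homW => g; apply: tangle_homW => f.
  apply: tangle_homW => g'; apply: tangle_homW => f' /=.
  rewrite !tangleE; exact/tangle_clsP/Teq_ten_comp.
- move=> m n p m' n' p'; apply: tangle_homW => f; apply: tangle_homW => g.
  apply: tangle_homW => h; rewrite !tangleE; exact/tangle_clsP/Teq_tenA.
- move=> m n; apply: tangle_homW => f; rewrite /= !tangleE.
  apply/tangle_clsP; exact: Teq_ten1l.
- move=> m n; apply: tangle_homW => f; rewrite /= !tangleE.
  apply/tangle_clsP; exact: Teq_ten1r.
Defined.

Definition Tangle : braided_strict_monoidal.
Proof.
refine (@BraidedStrictMonoidal Tangle_monoidal
  (fun m n => tangle_cls (Ttwist m n)) _ _ _ _).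
- move=> m n; exists (tangle_cls (TtwistV m n)).
  by split; rewrite /= tangleE; apply/tangle_clsP;
    [apply: Teq_twistK|apply: Teq_twistVK].
- move=> m n m' n'; apply: tangle_homW => f; apply: tangle_homW => g /=.
  rewrite !tangleE; exact/tangle_clsP/Teq_twist_nat.
- move=> m n p /=; rewrite !tangleE; exact/tangle_clsP/Teq_twist_tenr.
- move=> m n p /=; rewrite !tangleE; exact/tangle_clsP/Teq_twist_tenl.
Defined.

Definition tangle_X : Tangle := 1%N.
Definition tangle_eta : @hom Tangle munit (tangle_X ⊠ tangle_X) :=
  tangle_cls Teta.
Definition tangle_eps : @hom Tangle (tangle_X ⊠ tangle_X) munit :=
  tangle_cls Teps.

Section TupleSplit.
Variables (T : Type) (m n : nat).
Implicit Types (t : (m + n).-tuple T) (x : m.-tuple T) (y : n.-tuple T).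

Definition tleft t : m.-tuple T := [tuple tnth t (lshift n i) | i < m].
Definition tright t : n.-tuple T := [tuple tnth t (rshift m j) | j < n].

Lemma tleft_cat x y : tleft (cat_tuple x y) = x.
Proof. by apply: eq_from_tnth => i; rewrite tnth_mktuple; exact: tnth_lshift. Qed.

Lemma tright_cat x y : tright (cat_tuple x y) = y.
Proof. by apply: eq_from_tnth => i; rewrite tnth_mktuple; exact: tnth_rshift. Qed.

Lemma tcat_split t : cat_tuple (tleft t) (tright t) = t.
Proof.
apply: eq_from_tnth => i; case: (split_ordP i) => j ->.
  by rewrite [LHS]tnth_lshift tnth_mktuple.
by rewrite [LHS]tnth_rshift tnth_mktuple.
Qed.

Lemma tcatP (P : (m + n).-tuple T -> Prop) :
  (forall x y, P (cat_tuple x y)) -> forall t, P t.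
Proof. by move=> h t; rewrite -(tcat_split t). Qed.

End TupleSplit.

Section TSpan.
Variable G : groupType.
Implicit Types (g x y z : G) (m n p q : nat).

Definition central z : Prop := forall x, commute z x.

Definition tprod n (t : n.-tuple G) : G := \prod_(x <- t) x.

(* g x g^-1; the library's x ^ g is g^-1 x g *)
Definition lconj g x : G := g * x * g^-1.

Definition tconj n g (t : n.-tuple G) : n.-tuple G :=
  [tuple of map (lconj g) t].

(* n.-tuple G is the set denoted by the formal power n. *)
Record span m n := Span {
  apex : Type;
  legL : apex -> m.-tuple G;
  legR : apex -> n.-tuple G
}.

Definition span_iso m n (S T : span m n) : Prop :=
  exists f : apex S -> apex T,
    [/\ bijective f, forall s, legL (f s) = legL s
      & forall s, legR (f s) = legR s].

Definition is_tspan m n (S : span m n) : Prop :=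
  (exists act : G -> apex S -> apex S,
     [/\ forall g, bijective (act g),
         forall g s, legL (act g s) = tconj g (legL s)
       & forall g s, legR (act g s) = tconj g (legR s)])
  /\ (forall s : apex S, central (tprod (legL s) * (tprod (legR s))^-1)).

Record tspan m n := TSpanOf {
  tspan_span :> span m n;
  tspanP : is_tspan tspan_span
}.

Definition span_comp m n p (T : span n p) (S : span m n) : span m p :=
  @Span m p {st : apex S * apex T | legR st.1 = legL st.2}
    (fun st => legL (sval st).1) (fun st => legR (sval st).2).

Definition span_ten m n m' n' (S : span m n) (T : span m' n') :
    span (m + m') (n + n') :=
  @Span (m + m') (n + n') (apex S * apex T)%type
    (fun st => cat_tuple (legL st.1) (legL st.2))
    (fun st => cat_tuple (legR st.1) (legR st.2)).

Definition span_op m n (S : span m n) : span n m :=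
  Span (@legR m n S) (@legL m n S).

(* A function G^m -> G^n viewed as a span from G^m to G^n. *)
Definition span_of m n (f : m.-tuple G -> n.-tuple G) : span m n := Span id f.

Definition twist_fun m n (t : (m + n).-tuple G) : (n + m).-tuple G :=
  cat_tuple (tconj (tprod (tleft t)) (tright t)) (tleft t).

Definition gmul_fun (t : 2.-tuple G) : 1.-tuple G :=
  [tuple tnth t ord0 * tnth t ord_max].

Definition gone_fun (t : 0.-tuple G) : 1.-tuple G := [tuple 1].

Lemma lconjE g x : lconj g x = x ^ g^-1.
Proof. by rewrite /lconj conjgE invgK mulgA. Qed.

Lemma lconj1 x : lconj 1 x = x.
Proof. by rewrite lconjE invg1 conjg1. Qed.

Lemma lconjM g x y : lconj g (x * y) = lconj g x * lconj g y.
Proof. by rewrite !lconjE conjMg. Qed.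

Lemma lconjJ g h x : lconj g (lconj h x) = lconj (g * h) x.
Proof. by rewrite !lconjE invgM conjgM. Qed.

Lemma lconj_id z x : central z -> lconj z x = x.
Proof. by move=> cz; rewrite /lconj (cz x) mulgK. Qed.

Lemma lconjK g : cancel (lconj g) (lconj g^-1).
Proof. by move=> x; rewrite lconjJ mulVg lconj1. Qed.

Lemma lconjKV g : cancel (lconj g^-1) (lconj g).
Proof. by move=> x; rewrite lconjJ mulgV lconj1. Qed.

Lemma lconj_mod x y z : central (x * y^-1) -> lconj x z = lconj y z.
Proof. by move=> c; rewrite -[x](mulgVK y) -lconjJ lconj_id. Qed.

Lemma lconj_comm g x : lconj g x * g = g * x.
Proof. by rewrite /lconj mulgVK. Qed.

Lemma central1 : central 1.
Proof. by move=> x; apply: commute_sym; apply: commute1. Qed.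

Lemma centralM x y : central x -> central y -> central (x * y).
Proof.
by move=> cx cy z; apply: commute_sym; apply: commuteM; apply: commute_sym.
Qed.

Lemma centralV x : central x -> central x^-1.
Proof. by move=> cx z; apply: commute_sym; apply/commuteV/commute_sym. Qed.

Lemma tconjE n g (t : n.-tuple G) : tconj g t = map (lconj g) t :> seq G.
Proof. by []. Qed.

Lemma tconjK n g : cancel (@tconj n g) (@tconj n g^-1).
Proof.
by move=> t; apply: val_inj; rewrite /= -map_comp (eq_map (lconjK g)) map_id.
Qed.

Lemma tconjKV n g : cancel (@tconj n g^-1) (@tconj n g).
Proof.
by move=> t; apply: val_inj; rewrite /= -map_comp (eq_map (lconjKV g)) map_id.
Qed.

Lemma tconj_bij n g : bijective (@tconj n g).
Proof. exact: Bijective (@tconjK n g) (@tconjKV n g). Qed.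

Lemma tconj_cat m n g (x : m.-tuple G) (y : n.-tuple G) :
  tconj g (cat_tuple x y) = cat_tuple (tconj g x) (tconj g y).
Proof. by apply: val_inj; rewrite /= map_cat. Qed.

Lemma tconj_mod n x y (t : n.-tuple G) :
  central (x * y^-1) -> tconj x t = tconj y t.
Proof.
by move=> c; apply: val_inj; apply: eq_map => z; apply: lconj_mod.
Qed.

Lemma tconjJ n g h (t : n.-tuple G) : tconj g (tconj h t) = tconj (g * h) t.
Proof.
by apply: val_inj; rewrite /= -map_comp; apply: eq_map => z /=; apply: lconjJ.
Qed.

Lemma tprod_conj n g (t : n.-tuple G) : tprod (tconj g t) = lconj g (tprod t).
Proof.
rewrite /tprod big_map lconjE conjg_prod; apply: eq_bigr => i _.
exact: lconjE.
Qed.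

Lemma tprod_cat m n (x : m.-tuple G) (y : n.-tuple G) :
  tprod (cat_tuple x y) = tprod x * tprod y.
Proof. exact: big_cat. Qed.

Lemma tprodT m n (t : (m + n).-tuple G) :
  tprod t = tprod (tleft t) * tprod (tright t).
Proof. by rewrite -{1}(tcat_split t) tprod_cat. Qed.

Lemma tleft_conj m n g (t : (m + n).-tuple G) :
  tleft (tconj g t) = tconj g (tleft t).
Proof. by move: t; apply: tcatP => x y; rewrite tconj_cat !tleft_cat. Qed.

Lemma tright_conj m n g (t : (m + n).-tuple G) :
  tright (tconj g t) = tconj g (tright t).
Proof. by move: t; apply: tcatP => x y; rewrite tconj_cat !tright_cat. Qed.

Lemma twist_fun_cat m n (x : m.-tuple G) (y : n.-tuple G) :
  twist_fun (cat_tuple x y) = cat_tuple (tconj (tprod x) y) x.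
Proof. by rewrite /twist_fun tleft_cat tright_cat. Qed.

#[export] Instance span_iso_equiv m n : Equivalence (@span_iso m n).
Proof.
split.
- by move=> S; exists id; split=> //; exists id.
- move=> S T [f [[h fK hK] fL fR]]; exists h; split; first by exists f.
    by move=> t; rewrite -{2}(hK t) fL.
  by move=> t; rewrite -{2}(hK t) fR.
- move=> S T U [f [bf fL fR]] [h [bh hL hR]]; exists (h \o f).
  split; first exact: bij_comp.
    by move=> s /=; rewrite hL fL.
  by move=> s /=; rewrite hR fR.
Qed.

Definition tspan_iso m n (S T : tspan m n) : Prop := span_iso S T.

#[export] Instance tspan_iso_equiv m n : Equivalence (@tspan_iso m n).
Proof.
have [R S T] := span_iso_equiv m n.
split; [move=> x|move=> x y|move=> x y z]; [exact: R|exact: S|exact: T].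
Qed.

Lemma span_comp_iso m n p (T T' : span n p) (S S' : span m n) :
  span_iso T T' -> span_iso S S' ->
  span_iso (span_comp T S) (span_comp T' S').
Proof.
move=> [h [[h' hK h'K] hL hR]] [f [[f' fK f'K] fL fR]].
have P (w : apex (span_comp T S)) :
  legR (f (sval w).1) = legL (h (sval w).2) by rewrite fR hL (svalP w).
have Q (w : apex (span_comp T' S')) :
  legR (f' (sval w).1) = legL (h' (sval w).2).
  by rewrite -fR -hL f'K h'K (svalP w).
exists (fun w => exist _ (f (sval w).1, h (sval w).2) (P w)); split=> //=.
exists (fun w => exist _ (f' (sval w).1, h' (sval w).2) (Q w)).
  by move=> [[s t] st]; apply: eq_exist => /=; rewrite hK fK.
by move=> [[s t] st]; apply: eq_exist => /=; rewrite h'K f'K.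
Qed.

Lemma span_ten_iso m n m' n' (S S' : span m n) (T T' : span m' n') :
  span_iso S S' -> span_iso T T' -> span_iso (span_ten S T) (span_ten S' T').
Proof.
move=> [f [[f' fK f'K] fL fR]] [h [[h' hK h'K] hL hR]].
exists (fun st => (f st.1, h st.2)); split.
- exists (fun st => (f' st.1, h' st.2)) => -[s t] /=; first by rewrite hK fK.
  by rewrite h'K f'K.
- by move=> [s t] /=; rewrite fL hL.
- by move=> [s t] /=; rewrite fR hR.
Qed.

Lemma is_tspan_of m n (f : m.-tuple G -> n.-tuple G) :
    (forall g t, f (tconj g t) = tconj g (f t)) ->
    (forall t, central (tprod t * (tprod (f t))^-1)) ->
  is_tspan (span_of f).
Proof.
move=> fJ fZ; split=> //; exists (@tconj m); split=> // g; exact: tconj_bij.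
Qed.

Lemma is_tspan_id n : is_tspan (@span_of n n id).
Proof.
by apply: is_tspan_of => // t; rewrite mulgV; apply: central1.
Qed.

Lemma is_tspan_op m n (S : span m n) : is_tspan S -> is_tspan (span_op S).
Proof.
move=> [[act [actB actL actR]] Z]; split; first by exists act.
by move=> s; rewrite -invgF; apply/centralV/Z.
Qed.

Lemma is_tspan_comp m n p (T : span n p) (S : span m n) :
  is_tspan T -> is_tspan S -> is_tspan (span_comp T S).
Proof.
move=> [[a [aB aL aR]] aZ] [[b [bB bL bR]] bZ]; split; last first.
  move=> [[s t] /= st].
  have -> : tprod (legL s) * (tprod (legR t))^-1 =
      tprod (legL s) * (tprod (legR s))^-1
      * (tprod (legL t) * (tprod (legR t))^-1).
    by rewrite mulgA st mulgVK.
  exact: centralM.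
have P g (st : apex (span_comp T S)) :
  legR (b g (sval st).1) = legL (a g (sval st).2).
  by rewrite bR aL (svalP st).
exists (fun g st => exist _ (b g (sval st).1, a g (sval st).2) (P g st)).
split=> //=.
move=> g; have [a' aK a'K] := aB g; have [b' bK b'K] := bB g.
have inv (st : apex (span_comp T S)) :
  legR (b' (sval st).1) = legL (a' (sval st).2).
  case: st => -[s t] /= st; apply: (can_inj (@tconjK n g)).
  by rewrite -bR -aL a'K b'K.
exists (fun st => exist _ (b' (sval st).1, a' (sval st).2) (inv st)).
  by move=> [[s t] st]; apply: eq_exist => /=; rewrite aK bK.
by move=> [[s t] st]; apply: eq_exist => /=; rewrite a'K b'K.
Qed.

Lemma is_tspan_ten m n m' n' (S : span m n) (T : span m' n') :
  is_tspan S -> is_tspan T -> is_tspan (span_ten S T).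
Proof.
move=> [[a [aB aL aR]] aZ] [[b [bB bL bR]] bZ]; split; last first.
  move=> [s t] /=; rewrite !tprod_cat invgM.
  set x := tprod (legL s); set y := tprod (legL t).
  set x' := tprod (legR s); set y' := tprod (legR t).
  have -> : x * y * (y'^-1 * x'^-1) = x * x'^-1 * (y * y'^-1).
    by rewrite -!mulgA (mulgA y) [y * _ * _](bZ t).
  exact: (centralM (aZ s) (bZ t)).
exists (fun g st => (a g st.1, b g st.2)); split.
- move=> g; have [a' aK a'K] := aB g; have [b' bK b'K] := bB g.
  exists (fun st => (a' st.1, b' st.2)) => -[s t] /=.
    by rewrite aK bK.
  by rewrite a'K b'K.
- by move=> g [s t] /=; rewrite tconj_cat aL bL.
- by move=> g [s t] /=; rewrite tconj_cat aR bR.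
Qed.

Lemma twist_funJ m n g (t : (m + n).-tuple G) :
  twist_fun (tconj g t) = tconj g (twist_fun t).
Proof.
move: t; apply: tcatP => x y; rewrite tconj_cat !twist_fun_cat tconj_cat.
by rewrite tprod_conj !tconjJ lconj_comm.
Qed.

Lemma tprod_twist m n (t : (m + n).-tuple G) : tprod (twist_fun t) = tprod t.
Proof.
by rewrite /twist_fun tprod_cat tprod_conj lconj_comm -tprodT.
Qed.

Lemma is_tspan_twist m n : is_tspan (span_of (@twist_fun m n)).
Proof.
apply: is_tspan_of => [g t|t]; first exact: twist_funJ.
by rewrite tprod_twist mulgV; apply: central1.
Qed.

Lemma is_tspan_gmul : is_tspan (span_of gmul_fun).
Proof.
apply: is_tspan_of => [g t|t].
  by apply: val_inj; rewrite /= !tnth_map lconjM.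
have -> : tprod (gmul_fun t) = tprod t.
  rewrite /tprod /= big_cons big_nil mulg1.
  by case: t => -[|x [|y []]] // i; rewrite !big_cons big_nil mulg1 /tnth.
by rewrite mulgV; apply: central1.
Qed.

Lemma is_tspan_gone : is_tspan (span_of gone_fun).
Proof.
apply: is_tspan_of => [g t|t].
  by apply: val_inj; rewrite /= /lconj mulg1 mulgV.
by rewrite [t]tuple0 /tprod /= big_nil big_seq1 mul1g invg1; apply: central1.
Qed.

Definition tspan_hom m n : Type := quot (@tspan_iso m n).
Definition tspan_cls m n (S : tspan m n) : tspan_hom m n :=
  cls (@tspan_iso m n) S.

Definition tspan_comp m n p (T : tspan n p) (S : tspan m n) : tspan m p :=
  TSpanOf (is_tspan_comp (tspanP T) (tspanP S)).

Definition tspan_ten m n m' n' (S : tspan m n) (T : tspan m' n') :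
    tspan (m + m') (n + n') :=
  TSpanOf (is_tspan_ten (tspanP S) (tspanP T)).

Definition tspan_op m n (S : tspan m n) : tspan n m :=
  TSpanOf (is_tspan_op (tspanP S)).

Definition tspan_id n : tspan n n := TSpanOf (is_tspan_id n).
Definition tspan_twist m n : tspan (m + n) (n + m) :=
  TSpanOf (is_tspan_twist m n).

Definition thom_id n : tspan_hom n n := tspan_cls (tspan_id n).
Definition thom_comp m n p (g : tspan_hom n p) (f : tspan_hom m n) :=
  tspan_cls (tspan_comp (rep g) (rep f)).
Definition thom_ten m n m' n' (f : tspan_hom m n) (g : tspan_hom m' n') :=
  tspan_cls (tspan_ten (rep f) (rep g)).

Lemma tspan_clsP m n (S T : tspan m n) :
  tspan_cls S = tspan_cls T <-> span_iso S T.
Proof. exact: clsP. Qed.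

Lemma thom_compE m n p (T : tspan n p) (S : tspan m n) :
  thom_comp (tspan_cls T) (tspan_cls S) = tspan_cls (tspan_comp T S).
Proof. by apply/tspan_clsP; apply: span_comp_iso; apply: rep_cls. Qed.

Lemma thom_tenE m n m' n' (S : tspan m n) (T : tspan m' n') :
  thom_ten (tspan_cls S) (tspan_cls T) = tspan_cls (tspan_ten S T).
Proof. by apply/tspan_clsP; apply: span_ten_iso; apply: rep_cls. Qed.

Definition thomE := (thom_compE, thom_tenE).

Lemma thomW m n (P : tspan_hom m n -> Prop) :
  (forall S, P (tspan_cls S)) -> forall f, P f.
Proof. exact: clsW. Qed.

(* An isomorphism between spans whose feet are equal only as sequences. *)
Lemma thom_castP m m' n n' (em : m = m') (en : n = n')
    (S : tspan m n) (T : tspan m' n') (f : apex S -> apex T) :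
    bijective f ->
    (forall s, legL (f s) = legL s :> seq G) ->
    (forall s, legR (f s) = legR s :> seq G) ->
  cast2 em en (tspan_cls S) = tspan_cls T.
Proof.
case: _ / em T f; case: _ / en => T f bf fL fR; apply/tspan_clsP.
by exists f; split=> // s; apply: val_inj; [apply: fL|apply: fR].
Qed.

Lemma thom_comp1m m n (f : tspan_hom m n) : thom_comp (thom_id n) f = f.
Proof.
move: f; apply: thomW => S; rewrite thomE; apply/tspan_clsP.
exists (fun st : apex (span_comp (tspan_id n) S) => (sval st).1).
split=> //; last by move=> [[s t] /= st].
pose b s : apex (span_comp (tspan_id n) S) := exist _ (s, legR s) (erefl _).
exists b => //.
by move=> [[s t] /= st]; apply: eq_exist; rewrite /= st.
Qed.

Lemma thom_compm1 m n (f : tspan_hom m n) : thom_comp f (thom_id m) = f.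
Proof.
move: f; apply: thomW => S; rewrite thomE; apply/tspan_clsP.
exists (fun st : apex (span_comp S (tspan_id m)) => (sval st).2).
split=> //; last by move=> [[s t] /= st].
pose b s : apex (span_comp S (tspan_id m)) := exist _ (legL s, s) (erefl _).
exists b => //.
by move=> [[s t] /= st]; apply: eq_exist; rewrite /= -st.
Qed.

Lemma thom_compA m n p q (h : tspan_hom p q) (g : tspan_hom n p)
    (f : tspan_hom m n) :
  thom_comp h (thom_comp g f) = thom_comp (thom_comp h g) f.
Proof.
move: h g f; apply: thomW => U; apply: thomW => T; apply: thomW => S.
rewrite !thomE; apply/tspan_clsP.
have P (w : apex (span_comp U (span_comp T S))) :
  legR (sval (sval w).1).2 = legL (sval w).2 := svalP w.
have P' (w : apex (span_comp U (span_comp T S))) :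
  legR (sval (sval w).1).1 =
  @legL _ _ (span_comp U T) (exist _ ((sval (sval w).1).2, (sval w).2) (P w)).
  exact: svalP (sval w).1.
have Q (w : apex (span_comp (span_comp U T) S)) :
  legR (sval w).1 = legL (sval (sval w).2).1 := svalP w.
have Q' (w : apex (span_comp (span_comp U T) S)) :
  @legR _ _ (span_comp T S) (exist _ ((sval w).1, (sval (sval w).2).1) (Q w))
  = legL (sval (sval w).2).2.
  exact: svalP (sval w).2.
pose f w : apex (span_comp (span_comp U T) S) :=
  exist _ ((sval (sval w).1).1,
    exist _ ((sval (sval w).1).2, (sval w).2) (P w)) (P' w).
pose b w : apex (span_comp U (span_comp T S)) :=
  exist _ (exist _ ((sval w).1, (sval (sval w).2).1) (Q w),
    (sval (sval w).2).2) (Q' w).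
exists f; split=> //; exists b.
  move=> [[[[s t] st] u] tu]; apply: eq_exist; congr pair.
  exact: eq_exist.
move=> [[s [[t u] tu]] st]; apply: eq_exist; congr pair.
exact: eq_exist.
Qed.

Definition TSpan_category : category :=
  Category thom_comp1m thom_compm1 thom_compA.

Lemma thom_ten1 m n : thom_ten (thom_id m) (thom_id n) = thom_id (m + n).
Proof.
rewrite thomE; apply/tspan_clsP.
exists (fun xy : m.-tuple G * n.-tuple G => cat_tuple xy.1 xy.2).
split=> //.
exists (fun t => (tleft t, tright t)).
  by move=> [x y]; rewrite /= tleft_cat tright_cat.
by move=> t; rewrite /= tcat_split.
Qed.

Lemma cat_tuple_inj m n (x x' : m.-tuple G) (y y' : n.-tuple G) :
  cat_tuple x y = cat_tuple x' y' -> x = x' /\ y = y'.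
Proof.
move=> e; split.
  by rewrite -(tleft_cat x y) e tleft_cat.
by rewrite -(tright_cat x y) e tright_cat.
Qed.

Lemma thom_ten_comp m n p m' n' p' (g : tspan_hom n p) (f : tspan_hom m n)
    (g' : tspan_hom n' p') (f' : tspan_hom m' n') :
  thom_ten (thom_comp g f) (thom_comp g' f')
  = thom_comp (thom_ten g g') (thom_ten f f').
Proof.
move: g f g' f'; apply: thomW => T; apply: thomW => S.
apply: thomW => T'; apply: thomW => S'; rewrite !thomE; apply/tspan_clsP.
pose A := span_ten (span_comp T S) (span_comp T' S').
pose B := span_comp (span_ten T T') (span_ten S S').
have P (w : apex A) :
    legR (s := span_ten S S') ((sval w.1).1, (sval w.2).1)
    = legL (s := span_ten T T') ((sval w.1).2, (sval w.2).2).
  by rewrite /= (svalP w.1) (svalP w.2).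
have Q1 (w : apex B) : legR (sval w).1.1 = legL (sval w).2.1.
  by have /cat_tuple_inj[] := svalP w.
have Q2 (w : apex B) : legR (sval w).1.2 = legL (sval w).2.2.
  by have /cat_tuple_inj[] := svalP w.
pose fAB w : apex B :=
  exist _ (((sval w.1).1, (sval w.2).1), ((sval w.1).2, (sval w.2).2)) (P w).
pose fBA w : apex A :=
  (exist _ ((sval w).1.1, (sval w).2.1) (Q1 w),
   exist _ ((sval w).1.2, (sval w).2.2) (Q2 w)).
exists fAB; split=> //; exists fBA.
  by move=> [[[s t] st] [[s' t'] st']]; congr pair; apply: eq_exist.
by move=> [[[s s'] [t t']] st]; apply: eq_exist.
Qed.

Lemma thom_tenA m n p m' n' p' (f : tspan_hom m m') (g : tspan_hom n n')
    (h : tspan_hom p p') :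
  cast2 (addnA m n p) (addnA m' n' p') (thom_ten f (thom_ten g h))
  = thom_ten (thom_ten f g) h.
Proof.
move: f g h; apply: thomW => S; apply: thomW => T; apply: thomW => U.
rewrite !thomE.
apply: (@thom_castP _ _ _ _ _ _ (tspan_ten S (tspan_ten T U))
  (tspan_ten (tspan_ten S T) U) (fun w => ((w.1, w.2.1), w.2.2))).
- by exists (fun w => (w.1.1, (w.1.2, w.2))) => [[s [t u]]|[[s t] u]].
- by move=> [s [t u]]; rewrite /= catA.
- by move=> [s [t u]]; rewrite /= catA.
Qed.

Lemma thom_ten1l m n (f : tspan_hom m n) :
  cast2 (add0n m) (add0n n) (thom_ten (thom_id 0) f) = f.
Proof.
move: f; apply: thomW => S; rewrite thomE.
apply: (@thom_castP _ _ _ _ _ _ (tspan_ten (tspan_id 0) S) S snd).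
- by exists (fun s => ([tuple], s)) => // -[x s] /=; rewrite [x]tuple0.
- by move=> [x s] /=; rewrite [x]tuple0.
- by move=> [x s] /=; rewrite [x]tuple0.
Qed.

Lemma thom_ten1r m n (f : tspan_hom m n) :
  cast2 (addn0 m) (addn0 n) (thom_ten f (thom_id 0)) = f.
Proof.
move: f; apply: thomW => S; rewrite thomE.
apply: (@thom_castP _ _ _ _ _ _ (tspan_ten S (tspan_id 0)) S fst).
- by exists (fun s => (s, [tuple])) => // -[s x] /=; rewrite [x]tuple0.
- by move=> [s x] /=; rewrite [x]tuple0 cats0.
- by move=> [s x] /=; rewrite [x]tuple0 cats0.
Qed.

Definition TSpan_monoidal : strict_monoidal :=
  @StrictMonoidal TSpan_category 0 addn thom_ten thom_ten1 thom_ten_comp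
    addnA add0n addn0 thom_tenA thom_ten1l thom_ten1r.

Definition thom_twist m n : tspan_hom (m + n) (n + m) :=
  tspan_cls (tspan_twist m n).


Definition graph_of m n (a : tspan_hom m n) (f : m.-tuple G -> n.-tuple G) :=
  span_iso (rep a) (span_of f).

Lemma graph_cls m n (f : m.-tuple G -> n.-tuple G) cf :
  graph_of (tspan_cls (@TSpanOf m n (span_of f) cf)) f.
Proof. exact: (rep_cls (R := @tspan_iso m n)). Qed.

Lemma graph_eq m n (a a' : tspan_hom m n) f f' :
  graph_of a f -> graph_of a' f' -> f =1 f' -> a = a'.
Proof.
move=> af a'f' /funext ff'; rewrite -ff' in a'f'.
rewrite -(repK a) -(repK a'); apply/clsP.
by rewrite /tspan_iso; transitivity (span_of f) => //; symmetry.
Qed.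

Lemma graph_comp m n p (a : tspan_hom m n) (b : tspan_hom n p) f h :
  graph_of a f -> graph_of b h -> graph_of (thom_comp b a) (h \o f).
Proof.
move=> af bh.
have r : span_iso (rep (thom_comp b a)) (span_comp (rep b) (rep a)).
  exact: (rep_cls (R := @tspan_iso m p)).
rewrite /graph_of r (span_comp_iso bh af).
exists (fun w : apex (span_comp (span_of h) (span_of f)) => (sval w).1).
split=> //; last by move=> [[s t] /= ->].
pose k s : apex (span_comp (span_of h) (span_of f)) :=
  exist _ (s, f s) (erefl _).
by exists k => // -[[s t] /= st]; apply: eq_exist; rewrite /= -st.
Qed.

Lemma graph_ten m n m' n' (a : tspan_hom m n) (b : tspan_hom m' n') f h :
  graph_of a f -> graph_of b h ->
  graph_of (thom_ten a b) (fun t => cat_tuple (f (tleft t)) (h (tright t))).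
Proof.
move=> af bh.
have r : span_iso (rep (thom_ten a b)) (span_ten (rep a) (rep b)).
  exact: (rep_cls (R := @tspan_iso _ _)).
rewrite /graph_of r (span_ten_iso af bh).
exists (fun w : m.-tuple G * m'.-tuple G => cat_tuple w.1 w.2).
split=> //; last by move=> [s t]; rewrite /= tleft_cat tright_cat.
exists (fun t => (tleft t, tright t)).
  by move=> [s t]; rewrite /= tleft_cat tright_cat.
by move=> t; rewrite /= tcat_split.
Qed.

Lemma graph_cast m n m' n' (em : m = m') (en : n = n') (a : tspan_hom m n) f :
  graph_of a f ->
  graph_of (cast2 em en a) (fun t => tcast en (f (tcast (esym em) t))).
Proof. by case: _ / em; case: _ / en. Qed.

Lemma tcast_catA m n p (x : m.-tuple G) (y : n.-tuple G) (z : p.-tuple G) e :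
  tcast e (cat_tuple x (cat_tuple y z))
  = cat_tuple (cat_tuple x y) z.
Proof. by apply: val_inj; rewrite /= val_tcast /= catA. Qed.

Lemma tcast_catAV m n p (x : m.-tuple G) (y : n.-tuple G) (z : p.-tuple G) e :
  tcast e (cat_tuple (cat_tuple x y) z)
  = cat_tuple x (cat_tuple y z).
Proof. by apply: val_inj; rewrite /= val_tcast /= catA. Qed.

Lemma twist_fun_bij m n : bijective (@twist_fun m n).
Proof.
exists (fun t =>
  cat_tuple (tright t) (tconj (tprod (tright t))^-1 (tleft t))) => t.
  move: t; apply: tcatP => x y.
  by rewrite twist_fun_cat tleft_cat tright_cat tconjK.
move: t; apply: tcatP => x y.
by rewrite twist_fun_cat tleft_cat tright_cat tconjKV.
Qed.

Lemma thom_twist_iso m n :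
  is_iso (C := TSpan_category) (thom_twist m n : @hom TSpan_category _ _).
Proof.
exists (tspan_cls (tspan_op (tspan_twist m n))).
have [v fK vK] := twist_fun_bij m n.
set f := @twist_fun m n in fK vK.
split; rewrite /= thomE; apply/tspan_clsP.
  exists (fun w : apex (span_comp (span_op (span_of f)) (span_of f)) =>
    (sval w).1).
  split=> //; last by move=> [[s t] /= st]; apply: (can_inj fK).
  pose b s : apex (span_comp (span_op (span_of f)) (span_of f)) :=
    exist _ (s, s) (erefl _).
  exists b => // -[[s t] /= st]; apply: eq_exist => /=.
  by rewrite (can_inj fK st : s = t).
exists (fun w : apex (span_comp (span_of f) (span_op (span_of f))) =>
  f (sval w).1).
split=> //; last by move=> [[s t] /= ->].
pose b s : apex (span_comp (span_of f) (span_op (span_of f))) :=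
  exist _ (v s, v s) (erefl _).
exists b => [[[s t] /= st]|s /=]; last exact: vK.
by apply: eq_exist => /=; rewrite fK -st.
Qed.

Lemma thom_twist_nat m m' n n' (f : tspan_hom m m') (g : tspan_hom n n') :
  thom_comp (thom_twist m' n') (thom_ten f g)
  = thom_comp (thom_ten g f) (thom_twist m n).
Proof.
move: f g; apply: thomW => S; apply: thomW => T; rewrite !thomE.
apply/tspan_clsP.
have [_ SZ] := tspanP S; have [[a [aB aL aR]] _] := tspanP T.
have [a' aK] : exists a', forall k, cancel (a k) (a' k) /\ cancel (a' k) (a k).
  suff /choice[a' aK] : forall k, exists a', cancel (a k) a' /\ cancel a' (a k).
    by exists a'.
  by move=> k; have [b bK b'K] := aB k; exists b.
pose A := span_comp (span_of (@twist_fun m' n')) (span_ten S T).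
pose B := span_comp (span_ten T S) (span_of (@twist_fun m n)).
pose c (s : apex S) := tprod (legR s).
have cL (s : apex S) k (t : k.-tuple G) :
  tconj (tprod (legL s)) t = tconj (c s) t by exact/tconj_mod/SZ.
have P s t : legR (s := span_of (@twist_fun m n))
    (cat_tuple (legL s) (legL t)) = legL (s := span_ten T S) (a (c s) t, s).
  by rewrite /= twist_fun_cat cL aL.
have Q (w : apex B) : let s := (sval w).2.2 in let t := (sval w).2.1 in
    (sval w).1 = cat_tuple (legL s) (legL (a' (c s) t)).
  case: w => -[u [t s]] /=; move: u; apply: tcatP => x y.
  rewrite twist_fun_cat => /cat_tuple_inj[yt xs]; rewrite xs in yt *.
  suff -> : y = legL (a' (c s) t) by [].
  apply: (can_inj (@tconjK n (c s))).
  by rewrite -aL (aK _).2 -yt -cL.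
pose fAB (w : apex A) : apex B :=
  exist _ (_, (_, _)) (P (sval w).1.1 (sval w).1.2).
pose fBA (w : apex B) : apex A :=
  let st := ((sval w).2.2, a' (c (sval w).2.2) (sval w).2.1) in
  exist _ (st, legR (s := span_ten S T) st) (erefl _).
exists fAB; split.
- exists fBA.
    move=> [[[s t] u] /= stu]; apply: eq_exist => /=.
    by rewrite (aK _).1 -stu.
  move=> w; have := Q w; case: w => -[u [t s]] /= tsu uE.
  by apply: eq_exist => /=; rewrite (aK _).2 uE.
- by move=> [[[s t] u] stu].
- move=> [[[s t] u] /= <-].
  by rewrite twist_fun_cat aR.
Qed.

Lemma thom_twist_tenr m n p :
  cast2 (addnA m n p) (esym (addnA n p m)) (thom_twist m (n + p))
  = thom_comp (thom_ten (thom_id n) (thom_twist m p))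
      (cast2 (erefl _) (esym (addnA n m p))
         (thom_ten (thom_twist m n) (thom_id p))).
Proof.
apply: graph_eq.
- exact/graph_cast/graph_cls.
- apply: graph_comp; first by apply/graph_cast/graph_ten; apply: graph_cls.
  by apply: graph_ten; apply: graph_cls.
- apply: tcatP => t z; move: t; apply: tcatP => x y /=.
  by rewrite !(tcast_catAV, twist_fun_cat, tconj_cat, tleft_cat, tright_cat).
Qed.

Lemma thom_twist_tenl m n p :
  cast2 (esym (addnA m n p)) (addnA p m n) (thom_twist (m + n) p)
  = thom_comp (thom_ten (thom_twist m p) (thom_id n))
      (cast2 (erefl _) (addnA m p n)
         (thom_ten (thom_id m) (thom_twist n p))).
Proof.
apply: graph_eq.
- exact/graph_cast/graph_cls.
- apply: graph_comp; first by apply/graph_cast/graph_ten; apply: graph_cls.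
  by apply: graph_ten; apply: graph_cls.
- apply: tcatP => x t; move: t; apply: tcatP => y z /=.
  rewrite !(tcast_catA, twist_fun_cat, tleft_cat, tright_cat).
  by rewrite tconjJ tprod_cat.
Qed.

Definition TSpan : braided_strict_monoidal :=
  @BraidedStrictMonoidal TSpan_monoidal thom_twist thom_twist_iso
    thom_twist_nat thom_twist_tenr thom_twist_tenl.

Definition tspan_gmul : tspan 2 1 := TSpanOf is_tspan_gmul.
Definition tspan_gone : tspan 0 1 := TSpanOf is_tspan_gone.

Definition TSpan_G : TSpan := 1%N.
Definition TSpan_nabla : @hom TSpan (TSpan_G ⊠ TSpan_G) TSpan_G :=
  tspan_cls tspan_gmul.
Definition TSpan_n : @hom TSpan munit TSpan_G := tspan_cls tspan_gone.
Definition TSpan_Delta : @hom TSpan TSpan_G (TSpan_G ⊠ TSpan_G) :=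
  tspan_cls (tspan_op tspan_gmul).
Definition TSpan_e : @hom TSpan TSpan_G munit := tspan_cls (tspan_op tspan_gone).

End TSpan.

(* Main.v *)
(* Since Tangle is presented by generators and relations, the functor exists as
   soon as the defining relations hold in TSpan_G; beyond the braided strict
   monoidal laws these are the tangle algebra laws, and they hold because Δn
   and e∇ are, up to isomorphism, the two spans between the point and G × G
   with apex {(x, x⁻¹)}, a set that the twist (x, y) ↦ (xyx⁻¹, x) maps to
   itself.  The functor is unique because it is determined on generators. *)
Require Import Defs.
From mathcomp Require Import all_boot.
From mathcomp Require Import boolp.

Set Implicit Arguments.
Unset Strict Implicit.
Unset Printing Implicit Defensive.

(** Proofs of an equality are all equal, so a loop may be replaced by [erefl]. This discards the
    transports once a functor is known to be the identity on objects. *)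
Lemma cast2_id (O : Type) (H : O -> O -> Type) (A B : O) (eA : A = A)
    (eB : B = B) (f : H A B) : cast2 eA eB f = f.
Proof. by rewrite (Prop_irrelevance eA erefl) (Prop_irrelevance eB erefl). Qed.

(** Serves to determine the image of the inverse twist from that of the twist. *)
Lemma mcomp_inv_uniq (C : category) (A B : C) (f : hom A B) (g h : hom B A) :
  g ∘ f = idm A -> f ∘ h = idm B -> g = h.
Proof. by move=> gf fh; rewrite -[g]mcompm1 -fh mcompA gf mcomp1m. Qed.

Lemma tuple1E (T : Type) (t : 1.-tuple T) : t = [tuple tnth t ord0].
Proof. by apply: eq_from_tnth => i; rewrite (ord1 i). Qed.

Lemma tuple2E (T : Type) (t : 2.-tuple T) :
  t = [tuple tnth t ord0; tnth t ord_max].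
Proof. by case: t => -[|x [|y []]] // i; apply: val_inj; rewrite /= !(tnth_nth x). Qed.

(** * Arrows of [TSpan] described by bare spans *)

Section Representation.
Variable G : groupType.
Local Open Scope group_scope.
Implicit Types m n p : nat.

(** Here [S] carries no proof of [is_tspan], so a pullback can be traded for a simpler span by an
    isomorphism of spans alone. *)
Definition represents m n (a : tspan_hom G m n) (S : span G m n) : Prop :=
  span_iso (rep a) S.

Lemma represents_cls m n (S : tspan G m n) : represents (tspan_cls S) S.
Proof. exact: (rep_cls (R := @tspan_iso G m n)). Qed.

Lemma represents_iso m n (a : tspan_hom G m n) (S T : span G m n) :
  represents a S -> span_iso S T -> represents a T.
Proof. by move=> aS ST; rewrite /represents; transitivity S. Qed.

Lemma represents_eq m n (a b : tspan_hom G m n) (S : span G m n) :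
  represents a S -> represents b S -> a = b.
Proof.
move=> aS bS; rewrite -(repK a) -(repK b); apply/clsP.
by rewrite /tspan_iso; transitivity S => //; symmetry.
Qed.

Lemma represents_comp m n p (b : tspan_hom G n p) (a : tspan_hom G m n) T S :
  represents b T -> represents a S ->
  represents (thom_comp b a) (span_comp T S).
Proof.
move=> bT aS; apply: represents_iso (span_comp_iso bT aS).
exact: represents_cls.
Qed.

Lemma represents_ten m n m' n' (a : tspan_hom G m n) (b : tspan_hom G m' n')
    S T :
  represents a S -> represents b T ->
  represents (thom_ten a b) (span_ten S T).
Proof.
move=> aS bT; apply: represents_iso (span_ten_iso aS bT).
exact: represents_cls.
Qed.

(** * The arrows Δn and e∇ *)

Definition cup_span : span G 0 2 :=
  Span (fun x : G => [tuple]) (fun x => [tuple x; x^-1]).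

Definition tspan_cup : tspan_hom G 0 2 :=
  thom_comp (TSpan_Delta G) (TSpan_n G).
Definition tspan_cap : tspan_hom G 2 0 :=
  thom_comp (TSpan_e G) (TSpan_nabla G).

Lemma gmul_fun_eq1 (t : 2.-tuple G) u :
  gmul_fun t = gone_fun u -> t = [tuple tnth t ord0; (tnth t ord0)^-1].
Proof.
move=> /(congr1 (fun s => tnth s ord0)).
rewrite [tnth (gmul_fun t) _]/= [tnth (gone_fun u) _]/= => /mulg1_eq ->.
exact: tuple2E.
Qed.

Lemma gmul_fun_inv (x : G) : gmul_fun [tuple x; x^-1] = gone_fun [tuple].
Proof. by apply: val_inj; rewrite /= !(tnth_nth 1) /= mulgV. Qed.

(** The pullback consists of the pairs (x, y) with xy = 1; the first coordinate identifies it with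
    [G]. *)
Lemma represents_cup : represents tspan_cup cup_span.
Proof.
apply: represents_iso (represents_comp (represents_cls _) (represents_cls _)) _.
pose S := span_comp (span_op (span_of (@gmul_fun G))) (span_of (@gone_fun G)).
exists (fun w : apex S => tnth (sval w).2 ord0); split.
- exists (fun x => exist _ ([tuple], [tuple x; x^-1]) (esym (gmul_fun_inv x))).
    move=> [[u t] /= ut]; apply: eq_exist => /=.
    by rewrite [u]tuple0 -(gmul_fun_eq1 (esym ut)).
  by [].
- by move=> [[u t] ut] /=; rewrite [u]tuple0.
- by move=> [[u t] /= ut]; rewrite -(gmul_fun_eq1 (esym ut)).
Qed.

Lemma represents_cap : represents tspan_cap (span_op cup_span).
Proof.
apply: represents_iso (represents_comp (represents_cls _) (represents_cls _)) _.
pose S := span_comp (span_op (span_of (@gone_fun G))) (span_of (@gmul_fun G)).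
exists (fun w : apex S => tnth (sval w).1 ord0); split.
- exists (fun x => exist _ ([tuple x; x^-1], [tuple]) (gmul_fun_inv x)).
    move=> [[t u] /= ut]; apply: eq_exist => /=.
    by rewrite [u]tuple0 -(gmul_fun_eq1 ut).
  by [].
- by move=> [[t u] /= ut]; rewrite -(gmul_fun_eq1 ut).
- by move=> [[t u] ut] /=; rewrite [u]tuple0.
Qed.

(** * The tangle algebra laws *)

Lemma cup_cap_zigzag_l :
  thom_comp (thom_ten tspan_cap (thom_id G 1))
    (thom_ten (thom_id G 1) tspan_cup)
  = thom_id G 1.
Proof.
apply: (@represents_eq 1 1 _ _ (span_of id)); last exact: represents_cls.
have id1 : represents (thom_id G 1) (span_of id) by exact: represents_cls.
(* The middle object is given as 3, to which both 1 + 2 and 2 + 1 reduce. *)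
have := @represents_comp 1 3 1 _ _ _ _
  (represents_ten represents_cap id1)
  (represents_ten id1 represents_cup).
set S := span_comp _ _ => /represents_iso; apply.
have P (t : 1.-tuple G) :
    cat_tuple t [tuple (tnth t ord0)^-1; (tnth t ord0)^-1^-1]
    = cat_tuple [tuple tnth t ord0; (tnth t ord0)^-1] t :> 3.-tuple G.
  by rewrite (tuple1E t); apply: val_inj; rewrite /= !(tnth_nth 1) /= invgK.
pose b (t : 1.-tuple G) : apex S :=
  exist _ ((t, (tnth t ord0)^-1), (tnth t ord0, t)) (P t).
(* The matching condition reads (t, y, y⁻¹) = (x, x⁻¹, u), which forces y = x⁻¹ and t = u = x: the
   apex is a copy of [G]. *)
have E (w : apex S) : exists x,
    sval w = (([tuple x], x^-1), (x, [tuple x])).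
  case: w => -[[t y] [x u]] /= /(congr1 val).
  rewrite (tuple1E t) (tuple1E u) /= => -[-> -> <-]; exists x.
  by rewrite invgK.
exists (fun w : apex S => (sval w).1.1); split.
- exists b => // w; have := E w; case: w => w wP [x /= wE].
  by apply: eq_exist; rewrite /= wE !(tnth_nth 1).
- move=> w /=; have [x ->] := E w; exact: val_inj.
- move=> w /=; have [x ->] := E w; exact: val_inj.
Qed.

Lemma cup_cap_zigzag_r :
  thom_comp (thom_ten (thom_id G 1) tspan_cap)
    (thom_ten tspan_cup (thom_id G 1))
  = thom_id G 1.
Proof.
apply: (@represents_eq 1 1 _ _ (span_of id)); last exact: represents_cls.
have id1 : represents (thom_id G 1) (span_of id) by exact: represents_cls.
have := @represents_comp 1 3 1 _ _ _ _
  (represents_ten id1 represents_cap)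
  (represents_ten represents_cup id1).
set S := span_comp _ _ => /represents_iso; apply.
have P (t : 1.-tuple G) :
    cat_tuple [tuple tnth t ord0; (tnth t ord0)^-1] t
    = cat_tuple t [tuple (tnth t ord0)^-1; (tnth t ord0)^-1^-1] :> 3.-tuple G.
  by rewrite (tuple1E t); apply: val_inj; rewrite /= !(tnth_nth 1) /= invgK.
pose b (t : 1.-tuple G) : apex S :=
  exist _ ((tnth t ord0, t), (t, (tnth t ord0)^-1)) (P t).
(* The same equation with its sides exchanged: (x, x⁻¹, u) = (t, y, y⁻¹). *)
have E (w : apex S) : exists x,
    sval w = ((x, [tuple x]), ([tuple x], x^-1)).
  case: w => -[[x u] [t y]] /= /(congr1 val).
  rewrite (tuple1E t) (tuple1E u) /= => -[<- <- ->]; exists x.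
  by rewrite invgK.
exists (fun w : apex S => (sval w).1.2); split.
- exists b => // w; have := E w; case: w => w wP [x /= wE].
  by apply: eq_exist; rewrite /= wE !(tnth_nth 1).
- move=> w /=; have [x ->] := E w; exact: val_inj.
- move=> w /=; have [x ->] := E w; exact: val_inj.
Qed.

(** Conjugation by x fixes x⁻¹. *)
Lemma twist_fun_inv (x : G) :
  @twist_fun G 1 1 [tuple x; x^-1] = [tuple x^-1; x].
Proof.
rewrite (_ : [tuple x; x^-1] = cat_tuple [tuple x] [tuple x^-1]); last first.
  exact: val_inj.
apply: val_inj; rewrite twist_fun_cat /= /tprod big_seq1 /lconj.
by rewrite mulgV mul1g.
Qed.

Lemma twist_cup : thom_comp (thom_twist G 1 1) tspan_cup = tspan_cup.
Proof.
apply: represents_eq represents_cup.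
apply: represents_iso (represents_comp (represents_cls _) represents_cup) _.
set S := span_comp _ _.
pose b (x : G) : apex S := exist _ (x^-1, [tuple x^-1; x^-1^-1]) (erefl _).
(* The twist swaps x and x⁻¹, so inversion on the apex reparametrizes the composite as the cup. *)
exists (fun w : apex S => (sval w).1^-1); split.
- exists b => [[[x t] /= xt]|x]; last exact: invgK.
  by apply: eq_exist => /=; rewrite invgK -xt.
- by move=> [[x t] xt].
- by move=> [[x t] /= <-]; rewrite twist_fun_inv invgK.
Qed.

Lemma cap_twist : thom_comp tspan_cap (thom_twist G 1 1) = tspan_cap.
Proof.
apply: represents_eq represents_cap.
apply: represents_iso (represents_comp represents_cap (represents_cls _)) _.
set S := span_comp _ _.
have P (x : G) :
    @twist_fun G 1 1 [tuple x; x^-1] = [tuple x^-1; x^-1^-1].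
  by rewrite twist_fun_inv invgK.
pose b (x : G) : apex S := exist _ ([tuple x; x^-1], x^-1) (P x).
(* The twist is injective, so (x⁻¹, x) is the only pair that it sends to (x, x⁻¹). *)
have E (w : apex S) : (sval w).1 = [tuple (sval w).2^-1; (sval w).2^-1^-1].
  case: w => -[t x] /= tx; have [v vK _] := twist_fun_bij G 1 1.
  by apply: (can_inj vK); rewrite P !invgK.
exists (fun w : apex S => (sval w).2^-1); split.
- exists b => [w|x]; last exact: invgK.
  have := E w; case: w => -[t x] tx /= tE.
  by apply: eq_exist; rewrite /= -tE invgK.
- by move=> w; rewrite /= -E.
- by move=> [[t x] tx].
Qed.

(** * Interpretation of tangle terms *)

Definition thom_twistV m n : tspan_hom G (n + m) (m + n) :=
  sval (cid (thom_twist_iso G m n)).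

Lemma thom_twistK m n :
  thom_comp (thom_twistV m n) (thom_twist G m n) = thom_id G (m + n).
Proof. by rewrite /thom_twistV; case: cid => v []. Qed.

Lemma thom_twistVK m n :
  thom_comp (thom_twist G m n) (thom_twistV m n) = thom_id G (n + m).
Proof. by rewrite /thom_twistV; case: cid => v []. Qed.

Fixpoint eval_term m n (f : tangle_term m n) : tspan_hom G m n :=
  match f with
  | Tid n => thom_id G n
  | Tcomp _ _ _ g f => thom_comp (eval_term g) (eval_term f)
  | Tten _ _ _ _ f g => thom_ten (eval_term f) (eval_term g)
  | Ttwist m n => thom_twist G m n
  | TtwistV m n => thom_twistV m n
  | Teta => tspan_cup
  | Teps => tspan_cap
  end.

Lemma eval_cast m m' n n' (em : m = m') (en : n = n') (f : tangle_term m n) :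
  eval_term (cast2 em en f) = cast2 em en (eval_term f).
Proof. by case: _ / em; case: _ / en. Qed.

Lemma eval_eq m n (f g : tangle_term m n) :
  tangle_eq f g -> eval_term f = eval_term g.
Proof.
(* [congruence] settles the equivalence and compatibility clauses; each remaining clause is a law of
   [TSpan] or a tangle algebra law. *)
elim=> {m n f g} /=; try by move=> *; congruence.
- by move=> *; apply: thom_comp1m.
- by move=> *; apply: thom_compm1.
- by move=> *; apply: thom_compA.
- by move=> *; apply: thom_ten1.
- by move=> *; apply: thom_ten_comp.
- by move=> *; rewrite eval_cast; apply: thom_tenA.
- by move=> *; rewrite eval_cast; apply: thom_ten1l.
- by move=> *; rewrite eval_cast; apply: thom_ten1r.
- exact: thom_twistK.
- exact: thom_twistVK.
- by move=> *; apply: thom_twist_nat.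
- by move=> *; rewrite !eval_cast; apply: thom_twist_tenr.
- by move=> *; rewrite !eval_cast; apply: thom_twist_tenl.
- exact: cup_cap_zigzag_l.
- exact: cup_cap_zigzag_r.
- exact: cap_twist.
- exact: twist_cup.
Qed.

Definition eval_hom m n (f : tangle_hom m n) : tspan_hom G m n :=
  eval_term (rep f).

Lemma eval_homE m n (f : tangle_term m n) :
  eval_hom (tangle_cls f) = eval_term f.
Proof. by apply: eval_eq; apply: (rep_cls (R := @tangle_eq m n)). Qed.

(** Both categories have the natural numbers as objects and [addn] as tensor, so the equalities on
    objects are [erefl] and the transports compute away. *)
Definition eval_functor : bsm_functor Tangle (TSpan G).
Proof.
refine (@BSMFunctor Tangle (TSpan G) id eval_hom _ _ erefl
  (fun _ _ => erefl) _ _).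
- by move=> n; apply: eval_homE.
- by move=> m n p g f; apply: eval_homE.
- by move=> m n m' n' f g; apply: eval_homE.
- by move=> m n; apply: eval_homE.
Defined.

End Representation.

(** * Existence and uniqueness of the functor *)

Theorem corollary4p1 (G : groupType) :
  exists! F : bsm_functor Tangle (TSpan G),
    exists eX : F tangle_X = TSpan_G G,
      let eXX : F (tangle_X ⊠ tangle_X) = TSpan_G G ⊠ TSpan_G G :=
        etrans (fob_ten F tangle_X tangle_X) (f_equal (fun A => A ⊠ A) eX) in
      cast2 (fob_unit F) eXX (fhom F tangle_eta) = TSpan_Delta G ∘ TSpan_n G
      /\ cast2 eXX (fob_unit F) (fhom F tangle_eps) = TSpan_e G ∘ TSpan_nabla G.
Proof.
exists (eval_functor G); split; first by exists erefl; split; exact: eval_homE.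
case=> fo fh h1 hc e0 eT hT hW [eX [hU hE]].
(* Every object is a tensor power of the generator, so preservation of the unit, the tensor and the
   generator fixes the object map. *)
have foE : id = fo :> (nat -> nat).
  apply/funext; elim=> [|n IHn]; first exact: esym e0.
  rewrite (eT 1 n : fo n.+1 = fo 1 + fo n :> nat) -IHn.
  by rewrite (eX : fo 1 = 1 :> nat).
case: _ / foE fh h1 hc e0 eT hT hW eX hU hE => fh h1 hc e0 eT hT hW eX hU hE.
have fhE : (fun m n => @eval_hom G m n) = fh.
  apply: functional_extensionality_dep => m.
  apply: functional_extensionality_dep => n.
  apply/funext; apply: tangle_homW => f; rewrite eval_homE.
  elim: f => {m n} /=.
  - by move=> n; rewrite h1.
  - by move=> m n p g IHg f IHf; rewrite IHg IHf -tangle_compE hc.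
  - move=> m n m' n' f IHf g IHg; rewrite IHf IHg -tangle_tenE.
    by rewrite -[RHS](cast2_id (eT m m') (eT n n')) hT.
  - by move=> m n; rewrite -[RHS](cast2_id (eT m n) (eT n m)) hW.
  (* A functor preserves inverses, and both candidates are inverse to the same twist. *)
  - move=> m n; apply: (@mcomp_inv_uniq (TSpan G) _ _ (thom_twist G m n)).
      exact: thom_twistK.
    have -> : thom_twist G m n = fh _ _ (tangle_cls (Ttwist m n)).
      by rewrite -[RHS](cast2_id (eT m n) (eT n m)) hW.
    rewrite -hc -h1; congr (fh _ _ _).
    by rewrite /= tangleE; apply/tangle_clsP/Teq_twistVK.
  - by move: hU; rewrite cast2_id.
  - by move: hE; rewrite cast2_id.
case: _ / fhE h1 hc hT hW {eX hU hE} => h1 hc hT hW.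
rewrite /eval_functor.
(* The types of [hT] and [hW] mention [eT], so it is replaced by [erefl] before the remaining proofs
   are identified. *)
have e0E := Prop_irrelevance erefl e0.
have eTE := Prop_irrelevance (fun _ _ => erefl) eT.
case: _ / e0E; case: _ / eTE hT hW => hT hW.
by f_equal; apply: Prop_irrelevance.
Qed.
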